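(* Let $K$ be a commutative ring with $\frac12\in K$ and let $n\ge1$. Let $\mathcal I(K)$ be the set of ideals of the ring $K$, and let $\mathrm{SDI}(\Lambda_n)$ be the set of all skew differential ideals of the Grassmann algebra $\Lambda_n=\Lambda_n(K)$. Then the map $$\mathcal I(K)\to\mathrm{SDI}(\Lambda_n),\qquad I\mapsto I\Lambda_n,$$ is a bijection. In particular, if $K$ is a field of characteristic $\ne2$, then $\Lambda_n$ is a skew differentiably simple algebra, i.e. $0$ and $\Lambda_n$ are the only skew differential ideals of $\Lambda_n$.
   Context: $\Lambda_n=\Lambda_n(K)=K\lfloor x_1,\ldots,x_n\rfloor$ is the $K$-algebra with generators $x_1,\ldots,x_n$ and defining relations $x_i^2=0$, $x_ix_j=-x_jx_i$ ($i\ne j$). $\Lambda_n^{ev}$ (resp. $\Lambda_n^{od}$) is the $K$-span of the products of an even (resp. odd) number of distinct generators. A (left) skew $K$-derivation of $\Lambda_n$ is a $K$-linear map $\delta:\Lambda_n\to\Lambda_n$ such that $\delta(ab)=\delta(a)b+(-1)^s a\,\delta(b)$ for all parity-homogeneous $a,b$, where $s=0$ if $a\in\Lambda_n^{ev}$ and $s=1$ if $a\in\Lambda_n^{od}$. An ideal $\mathfrak a$ of $\Lambda_n$ is a skew differential ideal if $\delta(\mathfrak a)\subseteq\mathfrak a$ for every skew $K$-derivation $\delta$ of $\Lambda_n$. *)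

(* Defs.v *)
From HB Require Import structures.
From mathcomp Require Import classical_sets functions.
From mathcomp Require Import all_boot all_order all_algebra.

Set Implicit Arguments.
Unset Strict Implicit.
Unset Printing Implicit Defensive.

Import GRing.Theory.
Local Open Scope ring_scope.

(* The algebra with generators x_i and relations x_i ^+ 2 = 0,               *)
(* x_i * x_j = - x_j * x_i is realised on the free K-module with basis       *)
(* e_S, S : {set 'I_n}, where e_S stands for the product of the x_i, i in S, *)
(* in increasing order.  That this is the algebra presented by these         *)
(* generators and relations is grassmann_rel / grassmann_universal below.    *)
(* The coefficient ring may be trivial, in which case so is the algebra;     *)
(* MathComp's algType only covers nontrivial rings, hence the separate ring  *)
(* and module structures.                                                    *)
Definition grassmann (n : nat) (K : comPzRingType) : Type :=
  {ffun {set 'I_n} -> K^o}.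

Section GrassmannRing.
Variables (n : nat) (K : comPzRingType).
Implicit Types S T U V : {set 'I_n}.

HB.instance Definition _ :=
  GRing.Lmodule.copy (grassmann n K) {ffun {set 'I_n} -> K^o}.

Local Notation L := (grassmann n K).
Implicit Types a b c : L.

Definition ebasis S : L := [ffun T => (T == S)%:R].

(* e_T * e_U = 0 unless T and U are disjoint; otherwise moving the letters   *)
(* into increasing order costs one sign for each i in T and j in U, j < i.   *)
Definition inversions T U : nat := (\sum_(i in T) \sum_(j in U) (j < i))%N.

Definition esign T U : K :=
  if [disjoint T & U] then (-1) ^+ inversions T U else 0.

Definition gmul a b : L :=
  \sum_T \sum_U (a T * b U * esign T U) *: ebasis (T :|: U).

Definition gone : L := ebasis set0.

Definition gen (i : 'I_n) : L := ebasis [set i].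

Lemma disjointsUl T U V :
  [disjoint T :|: U & V] = [disjoint T & V] && [disjoint U & V].
Proof. by rewrite -!setI_eq0 setIUl setU_eq0. Qed.

Lemma disjointsUr T U V :
  [disjoint T & U :|: V] = [disjoint T & U] && [disjoint T & V].
Proof. by rewrite -!setI_eq0 setIUr setU_eq0. Qed.

Lemma inversionsUl T U V : [disjoint T & U] ->
  inversions (T :|: U) V = (inversions T V + inversions U V)%N.
Proof.
move=> dTU; rewrite /inversions -bigU //=.
by apply: eq_bigl => i; rewrite !inE.
Qed.

Lemma inversionsUr T U V : [disjoint U & V] ->
  inversions T (U :|: V) = (inversions T U + inversions T V)%N.
Proof.
move=> dUV; rewrite /inversions -big_split /=.
apply: eq_bigr => i _; rewrite -bigU //=.
by apply: eq_bigl => j; rewrite !inE.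
Qed.

Lemma esign_cocycle T U V :
  esign T U * esign (T :|: U) V = esign U V * esign T (U :|: V).
Proof.
rewrite /esign disjointsUl disjointsUr.
case dTU: [disjoint T & U]; case dTV: [disjoint T & V];
  case dUV: [disjoint U & V]; rewrite /= ?mulr0 ?mul0r //.
by rewrite inversionsUl // inversionsUr // !exprD mulrA mulrC.
Qed.

Lemma esign0l U : esign set0 U = 1.
Proof. by rewrite /esign -setI_eq0 set0I eqxx /inversions big_set0 expr0. Qed.

Lemma esign0r U : esign U set0 = 1.
Proof.
rewrite /esign -setI_eq0 setI0 eqxx /inversions.
by rewrite big1 ?expr0 // => i _; rewrite big_set0.
Qed.

Lemma ebasis_decomp a : a = \sum_S a S *: ebasis S.
Proof.
apply/ffunP => S; rewrite sum_ffunE (bigD1 S) //= big1 => [|T nTS].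
  by rewrite addr0 !ffunE eqxx /GRing.scale /= mulr1.
by rewrite !ffunE eq_sym (negbTE nTS) scaler0.
Qed.

Lemma gmulDl a b c : gmul (a + b) c = gmul a c + gmul b c.
Proof.
rewrite /gmul -big_split; apply: eq_bigr => T _ /=.
rewrite -big_split; apply: eq_bigr => U _ /=.
by rewrite ffunE -scalerDl -!mulrDl.
Qed.

Lemma gmulDr a b c : gmul a (b + c) = gmul a b + gmul a c.
Proof.
rewrite /gmul -big_split; apply: eq_bigr => T _ /=.
rewrite -big_split; apply: eq_bigr => U _ /=.
by rewrite ffunE -scalerDl -mulrDl -mulrDr.
Qed.

Lemma gmulZl (k : K) a b : gmul (k *: a) b = k *: gmul a b.
Proof.
rewrite /gmul scaler_sumr; apply: eq_bigr => T _.
rewrite scaler_sumr; apply: eq_bigr => U _.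
by rewrite ffunE scalerA /GRing.scale /= !mulrA.
Qed.

Lemma gmulZr (k : K) a b : gmul a (k *: b) = k *: gmul a b.
Proof.
rewrite /gmul scaler_sumr; apply: eq_bigr => T _.
rewrite scaler_sumr; apply: eq_bigr => U _.
by rewrite ffunE scalerA /GRing.scale /= !mulrA [a T * k]mulrC.
Qed.

Lemma gmul0l a : gmul 0 a = 0.
Proof. by rewrite -[0 in LHS](scale0r (0 : L)) gmulZl scale0r. Qed.

Lemma gmul0r a : gmul a 0 = 0.
Proof. by rewrite -[0 in LHS](scale0r (0 : L)) gmulZr scale0r. Qed.

Lemma gmul_suml (I : finType) (f : I -> L) a :
  gmul (\sum_i f i) a = \sum_i gmul (f i) a.
Proof.
by apply: (big_morph (fun x => gmul x a)) => [x y|]; rewrite ?gmulDl ?gmul0l.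
Qed.

Lemma gmul_sumr (I : finType) (f : I -> L) a :
  gmul a (\sum_i f i) = \sum_i gmul a (f i).
Proof. by apply: (big_morph (gmul a)) => [x y|]; rewrite ?gmulDr ?gmul0r. Qed.

Lemma gmul_ebasis T U :
  gmul (ebasis T) (ebasis U) = esign T U *: ebasis (T :|: U).
Proof.
rewrite /gmul (bigD1 T) //= [X in _ + X]big1 => [|T' nT]; last first.
  by rewrite big1 // => U' _; rewrite !ffunE (negbTE nT) !mul0r scale0r.
rewrite (bigD1 U) //= big1 => [|U' nU].
  by rewrite !ffunE !eqxx !mul1r !addr0.
by rewrite !ffunE (negbTE nU) mulr0 !mul0r scale0r.
Qed.

Lemma gmulA : associative gmul.
Proof.
move: gmul gmul_suml gmul_sumr gmulZl gmulZr gmul_ebasis => m sl sr Zl Zr mE.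
move=> a b c; rewrite (ebasis_decomp a) (ebasis_decomp b) (ebasis_decomp c).
rewrite !sl; apply: eq_bigr => T _.
rewrite sr [m _ (\sum_S b S *: ebasis S)]sr sl; apply: eq_bigr => U _.
rewrite !sr; apply: eq_bigr => V _.
rewrite !(Zl, Zr) !mE !(Zl, Zr) !mE !scalerA setUA; congr (_ *: _).
rewrite -!mulrA esign_cocycle [RHS]mulrCA; congr (_ * _).
by rewrite [RHS]mulrCA.
Qed.

Lemma gmul1l : left_id gone gmul.
Proof.
move=> a; rewrite (ebasis_decomp a) gmul_sumr; apply: eq_bigr => S _.
by rewrite gmulZr gmul_ebasis esign0l scale1r set0U.
Qed.

Lemma gmul1r : right_id gone gmul.
Proof.
move=> a; rewrite (ebasis_decomp a) gmul_suml; apply: eq_bigr => S _.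
by rewrite gmulZl gmul_ebasis esign0r scale1r setU0.
Qed.

HB.instance Definition _ := GRing.Zmodule_isPzRing.Build (grassmann n K)
  gmulA gmul1l gmul1r gmulDl gmulDr.

Lemma gscalerAl (k : K) a b : k *: (a * b) = (k *: a) * b.
Proof. exact: esym (gmulZl k a b). Qed.

Lemma gscalerAr (k : K) a b : k *: (a * b) = a * (k *: b).
Proof. exact: esym (gmulZr k a b). Qed.

Lemma ebasisM T U : ebasis T * ebasis U = esign T U *: ebasis (T :|: U).
Proof. exact: gmul_ebasis. Qed.

End GrassmannRing.

Arguments gen {n K} i.

Definition grassmann_relations (n : nat) (B : pzRingType) (y : 'I_n -> B) :=
  (forall i, y i ^+ 2 = 0) /\ (forall i j, i != j -> y i * y j = - (y j * y i)).

Section Presentation.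
Variables (n : nat) (K : comPzRingType).
Local Notation L := (grassmann n K).
Implicit Types S T U : {set 'I_n}.

Lemma grassmann_rel : grassmann_relations (@gen n K).
Proof.
split=> [i|i j nij]; first rewrite expr2 /gen ebasisM /esign.
  by rewrite disjoints1 set11 scale0r.
rewrite /gen !ebasisM /esign !disjoints1 !inE [j == i]eq_sym nij -scaleNr setUC.
congr (_ *: _); rewrite /inversions !big_set1.
by case: (ltngtP i j) nij => [_|_|/val_inj->]; rewrite ?eqxx ?expr0 ?expr1 ?opprK.
Qed.

Lemma enum_min S i : i \in S -> (forall j, j \in S -> i <= j)%N ->
  enum S = i :: enum (S :\ i).
Proof.
move=> iS mi; pose lto := [rel x y : 'I_n | (x < y)%N].
have lto_tr : transitive lto by move=> x y z; apply: ltn_trans.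
have so (A : {set 'I_n}) : sorted lto (enum A).
  rewrite {1}/enum_mem; apply: sorted_filter => //.
  have := iota_ltn_sorted 0 n; rewrite -val_enum_ord sorted_map.
  by rewrite enumT.
apply: (irr_sorted_eq lto_tr) => //.
- by move=> x; rewrite /= ltnn.
- rewrite /= path_min_sorted ?so //; apply/allP => j.
  rewrite mem_enum !inE => /andP[nji jS] /=.
  by rewrite ltn_neqAle mi // andbT eq_sym.
- by move=> j; rewrite inE !mem_enum !inE; case: eqP => [->|].
Qed.

Lemma set_min S : S != set0 ->
  exists2 i, i \in S & forall j, j \in S -> (i <= j)%N.
Proof.
case/set0Pn => i0 i0S; case: (arg_minnP (fun i : 'I_n => i : nat) i0S).
by move=> i iS mi; exists i.
Qed.

Lemma esign_lt (i : 'I_n) U : (forall j, j \in U -> i < j)%N -> esign K [set i] U = 1.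
Proof.
move=> mi; rewrite /esign disjoints1.
case: ifP => [_|/negbFE/mi]; last by rewrite ltnn.
rewrite /inversions big_set1 big1 ?expr0 // => j /mi ij.
by rewrite ltnNge ltnW.
Qed.

Lemma min_lt S (i : 'I_n) : (forall j, j \in S -> i <= j)%N ->
  forall j, j \in S :\ i -> (i < j)%N.
Proof.
move=> mi j; rewrite !inE => /andP[nji /mi].
by rewrite leq_eqVlt eq_sym (inj_eq val_inj) (negbTE nji).
Qed.

Lemma monomialE S : \prod_(i <- enum S) gen i = ebasis K S.
Proof.
have [m] := ubnP #|S|; elim: m S => // m IH S.
have [->|/set_min[i iS mi]] := eqVneq S set0.
  by rewrite enum_set0 big_nil.
rewrite (cardsD1 i) iS => ltSm; rewrite (enum_min iS mi) big_cons IH //.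
by rewrite /gen ebasisM esign_lt ?scale1r ?setD1K //; apply: min_lt.
Qed.

Section Universal.
Variables (B : pzRingType) (phi : {rmorphism K -> B}) (y : 'I_n -> B).
Hypothesis phi_central : forall k b, phi k * b = b * phi k.
Hypothesis y_rel : grassmann_relations y.

Let ymon S : B := \prod_(i <- enum S) y i.

Let ymonS S i : i \in S -> (forall j, j \in S -> i <= j)%N ->
  ymon S = y i * ymon (S :\ i).
Proof. by move=> iS mi; rewrite /ymon (enum_min iS mi) big_cons. Qed.

Let ymon1 i U : y i * ymon U = phi (esign K [set i] U) * ymon (i |: U).
Proof.
have [y2 yN] := y_rel.
have [m] := ubnP #|U|; elim: m U => // m IH U.
have [->|/set_min[k kU mk]] := eqVneq U set0.
  rewrite esign0r rmorph1 mul1r setU0 /ymon enum_set0 big_nil enum_set1.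
  by rewrite big_cons big_nil.
rewrite (cardsD1 k) kU => ltUm; have lk := min_lt mk.
have [lt_ik|lt_ki|/val_inj eik] := ltngtP i k.
- have niU : i \notin U by apply/negP => /mk; rewrite leqNgt lt_ik.
  rewrite esign_lt => [|j /mk]; last exact: leq_trans.
  rewrite rmorph1 mul1r [RHS](@ymonS _ i) ?setU11 ?setU1K //.
  by move=> j; rewrite !inE => /predU1P[-> //|/mk]; apply/leq_trans/ltnW.
- have nik : i != k by rewrite -(inj_eq val_inj) gtn_eqF.
  rewrite (ymonS kU mk) mulrA yN // mulNr -mulrA IH //.
  rewrite mulrA -phi_central -mulrA [ymon (i |: U)](@ymonS _ k); first last.
  - by move=> j; rewrite !inE => /predU1P[->|/mk //]; apply: ltnW.
  - by rewrite !inE kU orbT.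
  rewrite setDUl (_ : [set i] :\ k = [set i]); last first.
    by apply/setP => j; rewrite !inE; case: (eqVneq j i) => [->|]; rewrite ?nik ?andbF.
  rewrite -mulNr -rmorphN; congr (phi _ * _).
  rewrite /esign !disjoints1 !inE nik /=; case: ifP => _; last by rewrite oppr0.
  rewrite -[in RHS](setD1K kU) inversionsUr; last first.
    by rewrite disjoints1 !inE eqxx.
  by rewrite /inversions !big_set1 lt_ki exprD expr1 mulN1r.
- subst k; rewrite (ymonS kU mk) mulrA -expr2 y2 mul0r.
  by rewrite /esign disjoints1 kU rmorph0 mul0r.
Qed.

Let ymonM T U : ymon T * ymon U = phi (esign K T U) * ymon (T :|: U).
Proof.
have [m] := ubnP #|T|; elim: m T => // m IH T.
have [->|/set_min[k kT mk]] := eqVneq T set0.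
  by rewrite esign0l rmorph1 mul1r set0U /ymon enum_set0 big_nil mul1r.
rewrite (cardsD1 k) kT => ltTm.
rewrite (ymonS kT mk) -mulrA IH // mulrA -phi_central -mulrA ymon1 mulrA.
rewrite -rmorphM -esign_cocycle esign_lt; last exact: min_lt.
by rewrite mul1r setUA setD1K.
Qed.

Let lift (a : L) : B := \sum_S phi (a S) * ymon S.

Let lift_additive : zmod_morphism lift.
Proof.
move=> a b; rewrite /lift -sumrB; apply: eq_bigr => S _.
by rewrite !ffunE rmorphB mulrBl.
Qed.

HB.instance Definition _ := GRing.isZmodMorphism.Build L B lift lift_additive.

Let liftZ k (a : L) : lift (k *: a) = phi k * lift a.
Proof.
by rewrite /lift mulr_sumr; apply: eq_bigr => S _; rewrite ffunE rmorphM mulrA.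
Qed.

Let lift_ebasis S : lift (ebasis K S) = ymon S.
Proof.
rewrite /lift (bigD1 S) //= big1 => [|T nTS]; rewrite ffunE.
  by rewrite eqxx rmorph1 mul1r addr0.
by rewrite (negbTE nTS) rmorph0 mul0r.
Qed.

Let lift_multiplicative : monoid_morphism lift.
Proof.
split=> [|a b]; first by rewrite [1]/(ebasis K set0) lift_ebasis /ymon enum_set0 big_nil.
rewrite (ebasis_decomp a) (ebasis_decomp b) mulr_suml !raddf_sum /= mulr_suml.
apply: eq_bigr => T _; rewrite !mulr_sumr raddf_sum; apply: eq_bigr => U _ /=.
rewrite -gscalerAl -gscalerAr ebasisM !liftZ !lift_ebasis -ymonM -!mulrA.
by congr (_ * _); rewrite !mulrA phi_central.
Qed.

HB.instance Definition _ :=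
  GRing.isMonoidMorphism.Build L B lift lift_multiplicative.

(* A K-algebra B is given here by its structure map phi, with central image. *)
Lemma grassmann_universal :
  exists f : {rmorphism L -> B},
    [/\ forall k a, f (k *: a) = phi k * f a,
        forall i, f (gen i) = y i
      & forall g : {rmorphism L -> B},
          (forall k a, g (k *: a) = phi k * g a) ->
          (forall i, g (gen i) = y i) -> g =1 f].
Proof.
exists (lift : {rmorphism L -> B}); split=> [||g gZ gy a] /=.
- exact: liftZ.
- by move=> i; rewrite lift_ebasis /ymon enum_set1 big_cons big_nil mulr1.
rewrite (ebasis_decomp a) !raddf_sum; apply: eq_bigr => S _ /=.
rewrite gZ liftZ lift_ebasis -monomialE rmorph_prod; congr (_ * _).
by apply: eq_bigr.
Qed.

End Universal.
End Presentation.

Section SkewDifferential.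
Variables (n : nat) (K : comPzRingType).
Local Notation L := (grassmann n K).

Local Open Scope classical_set_scope.

(* The K-span of the products of an even (s = false) or odd (s = true)       *)
(* number of distinct generators.                                            *)
Definition parity_part (s : bool) : set L :=
  [set a | exists2 r : seq (K * seq 'I_n),
     all (fun t => uniq t.2 && (odd (size t.2) == s)) r
     & a = \sum_(t <- r) t.1 *: \prod_(i <- t.2) gen i].

Definition skew_derivation (d : {linear L -> L}) : Prop :=
  forall (s t : bool) (a b : L), parity_part s a -> parity_part t b ->
    d (a * b) = d a * b + (-1) ^+ s * (a * d b).

Definition ideal (R : pzRingType) : set (set R) :=
  [set I | [/\ I 0, forall a b, I a -> I b -> I (a + b)
             & forall r a, I a -> I (r * a) /\ I (a * r)]].

Definition skew_diff_ideal : set (set L) :=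
  [set J | @ideal L J /\
     forall d : {linear L -> L}, skew_derivation d -> d @` J `<=` J].

(* I |-> I L *)
Definition extend_ideal (I : set K) : set L :=
  [set a | exists2 r : seq (K * L),
     forall t, t \in r -> I t.1 & a = \sum_(t <- r) t.1 *: t.2].

Definition skew_diff_simple : Prop :=
  skew_diff_ideal = [set [set 0]; [set: L]].

End SkewDifferential.

Arguments ideal R : clear implicits.
Arguments skew_diff_ideal n K : clear implicits.
Arguments skew_diff_simple n K : clear implicits.

(* Main.v *)
Require Import Defs.
From HB Require Import structures.
From mathcomp Require Import classical_sets functions.
From mathcomp Require Import all_boot all_order all_algebra.

(** The left partial derivatives d_i are skew derivations, and x_i d_i is the
projection of the algebra onto the span of the monomials containing x_i. A skew
differential ideal J is stable under these projections and their complements,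
hence contains every term a_S x_S of each a in J; differentiating such a term
along S shows that J contains a_S. So J is generated by its constants. *)

Set Implicit Arguments.
Unset Strict Implicit.
Unset Printing Implicit Defensive.

Import GRing.Theory.
Local Open Scope ring_scope.

(** * Left partial derivatives and their skew Leibniz rule *)

Section PartialDerivative.
Variables (n : nat) (K : comPzRingType).
Local Notation L := (grassmann n K).
Implicit Types (i j : 'I_n) (S T U : {set 'I_n}) (a b : L).

Lemma esign1_in i S : i \in S -> esign K [set i] S = 0.
Proof. by move=> iS; rewrite /esign disjoints1 iS. Qed.

Lemma esign1_sqr i S : i \notin S -> esign K [set i] S * esign K [set i] S = 1.
Proof. by move=> niS; rewrite /esign disjoints1 niS -expr2 sqrr_sign. Qed.

Lemma esign1U i j S : i != j -> j \notin S ->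
  esign K [set i] (j |: S) = (-1) ^+ (j < i)%N * esign K [set i] S.
Proof.
move=> nij njS; rewrite /esign !disjoints1 !inE (negbTE nij) /=.
case: ifP => _; last by rewrite mulr0.
rewrite inversionsUr; last by rewrite disjoints1.
by rewrite {1}/inversions !big_set1 exprD.
Qed.

(** Exactly one of [j < i] and [i < j] holds, so the two signs produced by [esign1U] multiply to
    -1. *)
Lemma esign1_anticomm i j S : i != j -> i \notin S -> j \notin S ->
  esign K [set i] (j |: S) * esign K [set j] (i |: S)
  = - (esign K [set j] S * esign K [set i] S).
Proof.
move=> nij niS njS; have nji : j != i by rewrite eq_sym.
rewrite !esign1U // mulrACA.
rewrite [esign K [set i] S * _]mulrC.
case: (ltngtP i j) nij => [_ _|_ _|/val_inj->]; rewrite ?eqxx /= ?expr0 ?expr1 ?mulr1 ?mul1r ?mulN1r //.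
Qed.

Lemma genM_coef j a S :
  (gen j * a : L) S =
  if j \in S then esign K [set j] (S :\ j) * a (S :\ j) else 0.
Proof.
rewrite [in LHS](ebasis_decomp a) mulr_sumr sum_ffunE.
under eq_bigr => T _ do rewrite -gscalerAr ebasisM !ffunE /GRing.scale /=.
have [jS|njS] := boolP (j \in S); last first.
  apply: big1 => T _; case: eqP => [eS|_]; last by rewrite !mulr0.
  by rewrite eS setU11 in njS.
rewrite (bigD1 (S :\ j)) //= setD1K // eqxx mulr1 big1 ?addr0 1?mulrC //.
move=> T nT; have [jT|njT] := boolP (j \in T).
  by rewrite esign1_in // mul0r mulr0.
case: eqP => [eS|_]; last by rewrite !mulr0.
by rewrite eS setU1K // eqxx in nT.
Qed.

(** The left partial derivative in x_i, given on coefficients: x_i is moved to the front of a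
    monomial and deleted. For [i \in S] the sign is 0, so the result is free of x_i. *)
Definition pderiv i a : L := [ffun S => esign K [set i] S * a (i |: S)].

Lemma pderiv_linear i : linear (pderiv i).
Proof.
move=> k a b; apply/ffunP => S.
by rewrite !ffunE /GRing.scale /= mulrDr mulrCA.
Qed.

HB.instance Definition _ i :=
  GRing.isLinear.Build K L L *:%R (pderiv i) (pderiv_linear i).

(** The Clifford-type relation d_i x_j + x_j d_i = [i = j]; it is the one-letter case of the Leibniz
    rule. *)
Lemma pderiv_genM i j b :
  pderiv i (gen j * b) = (i == j)%:R *: b - gen j * pderiv i b.
Proof.
apply/ffunP => S; rewrite !ffunE !genM_coef !ffunE /GRing.scale /=.
have [<-|nij] := eqVneq i j.
  rewrite setU11 mul1r; have [iS|niS] := boolP (i \in S).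
    rewrite esign1_in // mul0r setD1K // mulrA esign1_sqr ?mul1r ?subrr //.
    by rewrite !inE eqxx.
  by rewrite setU1K // mulrA esign1_sqr // mul1r subr0.
rewrite mul0r sub0r !inE eq_sym (negbTE nij) /=.
have [jS|njS] := boolP (j \in S); last by rewrite mulr0 oppr0.
have [iS|niS] := boolP (i \in S).
  rewrite esign1_in // [esign K [set i] _]esign1_in ?inE ?nij //.
  by rewrite !mul0r mulr0 oppr0.
have eD : (i |: S) :\ j = i |: S :\ j.
  apply/setP => k; rewrite !inE.
  by case: (eqVneq k i) => [->|]; rewrite ?nij.
(* With [S] split into [j] and [S :\ j], both sides differ only by the order in which [i] and [j]
   are inserted. *)
rewrite eD -[S in esign K [set i] S](setD1K jS) !mulrA -mulNr.
by rewrite esign1_anticomm // !inE ?eqxx ?negb_and ?niS ?orbT.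
Qed.

Lemma pderiv1 i : pderiv i 1 = 0.
Proof.
apply/ffunP => S; rewrite !ffunE.
case: eqP => [e0|_]; last by rewrite mulr0.
by have := setU11 i S; rewrite e0 inE.
Qed.

(** Induction on the word [r]: by [pderiv_genM], passing each letter costs one sign. *)
Lemma pderiv_prodM i (r : seq 'I_n) b (m : L := \prod_(j <- r) gen j) :
  pderiv i (m * b) = pderiv i m * b + (-1) ^+ size r * (m * pderiv i b).
Proof.
rewrite {}/m; elim: r => [|j r IH].
  by rewrite big_nil pderiv1 mul0r add0r expr0 !mul1r.
rewrite big_cons -mulrA !pderiv_genM IH mulrDr mulrBl -gscalerAl opprD addrA.
rewrite !mulrA; congr (_ + _).
by rewrite exprS mulN1r !mulNr commr_sign.
Qed.

Lemma pderiv_skew_derivation i : skew_derivation (pderiv i).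
Proof.
move=> s t a b [r /allP rs ->] _; rewrite mulr_suml !raddf_sum /=.
rewrite !mulr_suml mulr_sumr -big_split /=; apply: eq_big_seq => u /rs.
move=> /andP[_ /eqP su]; rewrite -gscalerAl !linearZ /= pderiv_prodM.
(* The sign depends only on the parity of the word length, which is [s] for every term of [a]. *)
by rewrite -signr_odd su -!gscalerAl -gscalerAr scalerDr.
Qed.

(** Multiplying by x_i and applying [pderiv] introduce the same sign, whose square is 1. *)
Lemma gen_pderiv_coef i a S : (gen i * pderiv i a) S = if i \in S then a S else 0.
Proof.
rewrite genM_coef ffunE; case: ifP => // iS.
by rewrite setD1K // mulrA esign1_sqr ?mul1r // !inE eqxx.
Qed.

Lemma pderiv_ebasis i S : i \in S ->
  pderiv i (ebasis K S) = esign K [set i] (S :\ i) *: ebasis K (S :\ i).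
Proof.
move=> iS; apply/ffunP => T; rewrite !ffunE /GRing.scale /=.
have [iT|niT] := boolP (i \in T).
  rewrite esign1_in // mul0r; case: eqP => [eT|_]; last by rewrite mulr0.
  by rewrite eT !inE eqxx in iT.
have -> : (i |: T == S) = (T == S :\ i).
  apply/eqP/eqP => [<-|->]; last by rewrite setD1K.
  by rewrite setU1K.
by case: eqP => [->|_]; rewrite ?mulr0.
Qed.

End PartialDerivative.

Section SkewDifferentialIdeals.
Variables (n : nat) (K : comPzRingType).
Local Notation L := (grassmann n K).
Implicit Types (S T : {set 'I_n}) (a b : L) (I : set K) (J : set L).

Lemma scale_mulr1 (k : K) a : k *: a = k *: (1 : L) * a.
Proof. by rewrite -gscalerAl mul1r. Qed.

Lemma one_coef0 : (1 : L) set0 = 1.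
Proof. by rewrite ffunE eqxx. Qed.

(** * A skew differential ideal is generated by its constants *)

Section Constants.
Variable J : set L.
Hypothesis sdiJ : skew_diff_ideal n K J.

Let J0 : J 0. Proof. by case: sdiJ => -[]. Qed.

Let JD a b : J a -> J b -> J (a + b).
Proof. by case: sdiJ => -[_ + _ _]; apply. Qed.

Let JM a b : J b -> J (a * b).
Proof. by case: sdiJ => -[_ _ M] _ /(M a)[]. Qed.

Let JMr a b : J a -> J (a * b).
Proof. by case: sdiJ => -[_ _ M] _ /(M b)[]. Qed.

Let JZ (k : K) a : J a -> J (k *: a).
Proof. by rewrite scale_mulr1; apply: JM. Qed.

Let Jpderiv i a : J a -> J (pderiv i a).
Proof.
by move=> Ja; case: sdiJ => _ /(_ _ (pderiv_skew_derivation i)); apply; exists a.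
Qed.

Lemma skew_diff_ideal_term a S : J a -> J (a S *: ebasis K S).
Proof.
move=> Ja.
(* A sieve: [part r] keeps the terms of [a] whose index set agrees with [S] on the letters of [r].
   The empty list gives [a]; the full list leaves only the term at [S]. *)
pose part (r : seq 'I_n) : L :=
  [ffun T : {set 'I_n} => if all (fun i => (i \in T) == (i \in S)) r then a T else 0].
have -> : a S *: ebasis K S = part (enum 'I_n).
  apply/ffunP => T; rewrite !ffunE /GRing.scale /=.
  have -> : all (fun i => (i \in T) == (i \in S)) (enum 'I_n) = (T == S).
    apply/allP/eqP => [TS|-> //]; apply/setP => i; apply/eqP/TS.
    by rewrite mem_enum.
  by case: eqP => [->|_]; rewrite ?mulr1 ?mulr0.
elim: (enum 'I_n) => [|i r IH].
  by rewrite (_ : part [::] = a) //; apply/ffunP => T; rewrite ffunE.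
have JQ : J (gen i * pderiv i (part r)) by apply/JM/Jpderiv.
(* Sieving by one more letter is the projection x_i d_i or its complement. *)
have -> : part (i :: r) = if i \in S then gen i * pderiv i (part r)
    else part r - gen i * pderiv i (part r).
  apply/ffunP => T; case: ifP => iS.
    by rewrite gen_pderiv_coef !ffunE /= iS eqb_id; case: (i \in T).
  rewrite [RHS]ffunE [X in _ + X]ffunE gen_pderiv_coef !ffunE /= iS eqbF_neg.
  by case: (i \in T); rewrite ?subrr ?subr0.
by case: ifP => _ //; apply: JD => //; rewrite -scaleN1r; apply: JZ.
Qed.

Lemma skew_diff_ideal_coef a S : J a -> J (a S *: (1 : L)).
Proof.
(* The coefficient is generalized because the induction shrinks [S] while keeping the scalar
   fixed. *)
move=> /(skew_diff_ideal_term S); move: (a S) => k.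
have [m] := ubnP #|S|; elim: m S => // m IH S.
have [->|[i iS]] := set_0Vmem S; first by [].
rewrite (cardsD1 i) iS => ltSm /(Jpderiv i); rewrite linearZ /= pderiv_ebasis //.
(* Scaling by the sign once more undoes the one created by differentiation. *)
move=> /(JZ (esign K [set i] (S :\ i))); rewrite !scalerA mulrAC esign1_sqr.
  by rewrite mul1r; apply: IH.
by rewrite !inE eqxx.
Qed.

(** The contraction of [J] along the structure map from [K], which will be the inverse of
    [extend_ideal]. *)
Definition constants : set K := [set k | J (k *: (1 : L))]%classic.

Lemma ideal_constants : ideal K constants.
Proof.
split=> [|k l Jk Jl|k l Jl]; rewrite /constants /=.
- by rewrite scale0r.
- by rewrite scalerDl; apply: JD.
- by split; last rewrite mulrC; rewrite -scalerA; apply: JZ.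
Qed.

Lemma extend_constants : extend_ideal constants = J.
Proof.
apply/seteqP; split=> [_ [r rI ->]|a Ja].
  rewrite big_seq; elim/big_rec: _ => // t b tr Jb; apply: JD => //.
  by rewrite scale_mulr1; apply/JMr/rI.
(* The witness is the expansion of [a] in the monomial basis. *)
exists [seq (a T, ebasis K T) | T <- enum {: {set 'I_n}}].
  by move=> _ /mapP[S _ ->]; apply: skew_diff_ideal_coef.
by rewrite big_map big_enum /= -ebasis_decomp.
Qed.

End Constants.

(** * Extension followed by contraction, and the bijection *)

Lemma extend_ideal_coef I a S : ideal K I -> extend_ideal I a -> I (a S).
Proof.
move=> [I0 ID IM] [r rI ->]; rewrite sum_ffunE big_seq.
elim/big_rec: _ => // t k tr Ik; apply: ID => //.
by rewrite ffunE; case: (IM (t.2 S) _ (rI _ tr)).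
Qed.

Lemma extend_ideal_scale I (k : K) a : I k -> extend_ideal I (k *: a).
Proof.
move=> Ik; exists [:: (k, a)]; last by rewrite big_seq1.
by move=> t; rewrite inE => /eqP->.
Qed.

(** Multiplications and skew derivations are [K]-linear, so they act on the second factors of a sum
    and leave the scalars from [I] in place. *)
Lemma skew_diff_ideal_extend I : skew_diff_ideal n K (extend_ideal I).
Proof.
split=> [|d _ _ [_ [r rI ->] <-]]; last first.
  exists [seq (t.1, d t.2) | t <- r]; first by move=> _ /mapP[t /rI It ->].
  by rewrite raddf_sum big_map; apply: eq_bigr => t _; rewrite /= linearZ.
split=> [|_ _ [r rI ->] [q qI ->]|b _ [r rI ->]].
- by exists [::]; rewrite ?big_nil.
- exists (r ++ q); last by rewrite big_cat.
  by move=> t; rewrite mem_cat => /orP[/rI|/qI].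
split.
- exists [seq (t.1, b * t.2) | t <- r]; first by move=> _ /mapP[t /rI It ->].
  by rewrite mulr_sumr big_map; apply: eq_bigr => t _; rewrite gscalerAr.
- exists [seq (t.1, t.2 * b) | t <- r]; first by move=> _ /mapP[t /rI It ->].
  by rewrite mulr_suml big_map; apply: eq_bigr => t _; rewrite gscalerAl.
Qed.

Lemma constants_extend I : ideal K I -> constants (extend_ideal I) = I.
Proof.
move=> idI; apply/seteqP; split=> k; last exact: extend_ideal_scale.
(* The scalar [k] is read off as the coefficient of [k *: 1] at the empty set. *)
by move=> /(extend_ideal_coef set0 idI); rewrite ffunE one_coef0 /GRing.scale /= mulr1.
Qed.

Lemma extend_ideal_bij : set_bij (ideal K) (skew_diff_ideal n K) (@extend_ideal n K).
Proof.
split=> [I _|I I'|J sdiJ]; first exact: skew_diff_ideal_extend.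
  move=> /set_mem idI /set_mem idI' eII'.
  by rewrite -(constants_extend idI) eII' constants_extend.
by exists (constants J); [apply: ideal_constants | apply: extend_constants].
Qed.

End SkewDifferentialIdeals.

(** The ideal [constants J] of a field is everything or zero according to whether it contains 1, and
    [J] is its extension. *)
Lemma field_skew_diff_simple (n : nat) (K : fieldType) : skew_diff_simple n K.
Proof.
apply/seteqP; split=> [J sdiJ|_ [->|->]]; last first.
- by split=> // d _ _ [a _ <-].
- split=> [|d _ _ [_ -> <-]]; last by rewrite /= linear0.
  by split=> [|_ _ -> ->|a _ ->] /=; rewrite ?addr0 ?mulr0 ?mul0r.
have [JE [I0 _ IM]] := (extend_constants sdiJ, ideal_constants sdiJ).
have [I1|nI1] := boolp.pselect (constants J 1); [right | left].
  apply/seteqP; split=> // a _; rewrite -JE -[a]scale1r.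
  exact: extend_ideal_scale.
apply/seteqP; split=> [a|_ ->]; last by case: sdiJ => -[].
rewrite -JE => -[r rI ->]; rewrite big_seq big1 //= => t /rI It.
have [->|t0] := eqVneq t.1 0; first by rewrite scale0r.
(* A nonzero scalar in the ideal would be invertible and force 1 into it. *)
by case: nI1; rewrite -(mulVf t0); apply: (IM _ _ It).1.
Qed.

Theorem lemma3p3 (n : nat) (hn : (1 <= n)%N) :
  (forall K : comPzRingType, (exists h : K, 2%:R * h = 1) ->
     set_bij (ideal K) (skew_diff_ideal n K) (@extend_ideal n K)) /\
  (forall K : fieldType, 2%N \notin [pchar K] -> skew_diff_simple n K).
Proof.
by split=> K _; [apply: extend_ideal_bij | apply: field_skew_diff_simple].
Qed.
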